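(* Let $q$ be an odd prime power. For each integer $d\ge 3$ let $\mathcal{F}_d$ be the set of square-free monic polynomials of degree $d$ in $\mathbb{F}_q[X]$, and for $F\in\mathcal{F}_d$ let $S(F)=\sum_{x\in\mathbb{F}_q}\chi(F(x))$. Let $X_1,\dots,X_q$ be independent identically distributed random variables taking the values $0,1,-1$ with probabilities $\frac{1}{q+1}$, $\frac{1}{2(1+q^{-1})}$, $\frac{1}{2(1+q^{-1})}$ respectively. If $q$ is fixed and $d$ tends to infinity, then the distribution of $S(F)$, as $F$ ranges over all elements of $\mathcal{F}_d$ (with uniform probability), is asymptotically that of $\sum_{i=1}^q X_i$. More precisely, for every $s\in\mathbb{Z}$ with $|s|\le q$, $$\frac{|\{F\in\mathcal{F}_d : S(F)=s\}|}{|\mathcal{F}_d|}=\operatorname{Prob}\left(\sum_{i=1}^q X_i=s\right)\cdot\left(1+O\left(q^{(3q-d)/2}\right)\right),$$ where the implied constant is absolute (independent of $q$, $d$ and $s$).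
   Context: $\mathbb{F}_q$ is the finite field with $q$ elements, $q$ odd. $\chi$ is the quadratic character of $\mathbb{F}_q^\times$, extended by $\chi(0)=0$: $\chi(a)=1$ if $a$ is a nonzero square, $\chi(a)=-1$ if $a$ is a nonsquare. A polynomial is square-free if it is not divisible by the square of any nonconstant polynomial. An expression $A(1+O(B))$ with absolute implied constant means $A(1+\theta)$ with $|\theta|\le CB$, where $C$ is a universal constant. *)

(* Defs.v *)
From HB Require Import structures.
From mathcomp Require Import all_boot all_order all_algebra.
From mathcomp Require Import all_classical all_reals all_analysis.
Set Implicit Arguments.
Unset Strict Implicit.
Unset Printing Implicit Defensive.
Import Order.TTheory GRing.Theory Num.Theory.
Import numFieldNormedType.Exports.
Local Open Scope classical_set_scope.
Local Open Scope ring_scope.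

Definition quad_char (F : finFieldType) (a : F) : int :=
  if a == 0 then 0 else if [exists b : F, b ^+ 2 == a] then 1 else - 1.

(* [size g] is [deg g + 1], so [1 < size g] says that [g] is nonconstant. *)
Definition square_free (F : fieldType) (f : {poly F}) : Prop :=
  forall g : {poly F}, (1 < size g)%N -> ~~ (g ^+ 2 %| f).

(* [{poly_(d.+1) F}] is the finite type of polynomials of size at most [d.+1],
   i.e. of degree at most [d]. *)
Definition sqfree_monic (F : finFieldType) (d : nat) : {set {poly_(d.+1) F}} :=
  [set f : {poly_(d.+1) F} | [&& size (f : {poly F}) == d.+1,
     (f : {poly F}) \is monic & `[< square_free (f : {poly F}) >]]]%SET.

Definition char_sum (F : finFieldType) (f : {poly F}) : int :=
  \sum_(x : F) quad_char f.[x].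

Definition char_sum_freq (R : realType) (F : finFieldType) (d : nat) (s : int)
    : R :=
  #|[set f in sqfree_monic F d | char_sum f == s]%SET|%:R
    / #|sqfree_monic F d|%:R.

Definition mutually_independent (disp : measure_display)
    (T : measurableType disp) (R : realType) (P : probability T R) (n : nat)
    (X : 'I_n -> {RV P >-> R}) : Prop :=
  forall (J : {set 'I_n}) (A : 'I_n -> set R),
    (forall i, i \in J -> measurable (A i)) ->
    P (\bigcap_(i in [set` J]) (X i @^-1` A i)) =
      (\prod_(i in J) P (X i @^-1` A i))%E.

Definition iid_point_model (disp : measure_display)
    (T : measurableType disp) (R : realType) (P : probability T R) (q : nat)
    (X : 'I_q -> {RV P >-> R}) : Prop :=
  mutually_independent X /\
  forall i, [/\ pmf (X i) 0 = 1 / (q%:R + 1),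
                pmf (X i) 1 = 1 / (2 * (1 + q%:R^-1)) &
                pmf (X i) (- 1) = 1 / (2 * (1 + q%:R^-1))].

Definition sum_prob (disp : measure_display)
    (T : measurableType disp) (R : realType) (P : probability T R) (q : nat)
    (X : 'I_q -> {RV P >-> R}) (s : int) : R :=
  fine (P [set w | \sum_(i < q) X i w = s%:~R]).

(* Main.v *)
(** Inclusion-exclusion over finite sets [J] of monic irreducibles gives
    [G square-free] = sum_J (-1)^|J| [(prod J)^2 | G].  Hence the number of
    square-free monic [G] of degree [e] with prescribed nonzero values at all
    points of F_q is a signed sum of numbers of monic polynomials of degree
    [e - 2 deg (prod J)] with prescribed values; each of these is exactly
    [q^(n - q)] for degree [n >= q] and at most [1] for [n < q].  Since
    [J -> prod J] is injective, at most [q^j] sets have [deg (prod J) = j], so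
    replacing every count by [q^(n - q)] costs [O(q^(e/2))].  What remains is the
    Euler product over nonlinear irreducibles at [q^-2], that is
    [(1 - 1/q) / (1 - q^-2)^q]: the full product is [1 - q v] at [v = q^-2], and the
    [q] linear factors contribute [(1 - v)^q].

    If [F] vanishes exactly on [Z], with [|Z| = m], then [F] is the product of the
    [X - z], [z] in [Z], and of a square-free [G] of degree [d - m] without roots.
    Summing the count of such [G] over the values compatible with a given sign
    pattern and dividing by [q^d - q^(d-1)] yields the probability of the pattern
    as main term, with relative error [O(q^(q - (d - m)/2))], which is
    [O(q^((3q - d)/2))] because [m <= q].  These relative errors are uniform in the
    pattern, so they survive summation over all patterns of sum [s]. *)

Require Import Defs.
From HB Require Import structures.
From mathcomp Require Import all_boot all_order all_algebra.
From mathcomp Require Import all_classical all_reals all_analysis.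
From mathcomp Require Import ring lra zify.
Set Implicit Arguments.
Unset Strict Implicit.
Unset Printing Implicit Defensive.
Import Order.TTheory GRing.Theory Num.Theory.
Import numFieldNormedType.Exports.
Local Open Scope classical_set_scope.
Local Open Scope ring_scope.

(** * Monic polynomials with prescribed values *)

Section MonicPolynomials.
Variable F : finFieldType.
Implicit Types (G P : {poly F}) (n : nat).

(** A duplicate-free list in [{poly F}] itself, so that [count] takes any predicate and products can
    change the degree without a change of type. *)
Definition monics n : seq {poly F} :=
  [seq 'X^n + (p : {poly F}) | p : {poly_n F}].

Lemma mem_monics n G : (G \in monics n) = (G \is monic) && (size G == n.+1).
Proof.
apply/fintype.imageP/andP => [[p _ ->]|[Gm /eqP sG]].
  have sp : (size (p : {poly F}) < size ('X^n : {poly F}))%N.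
    by rewrite size_polyXn ltnS size_npoly.
  by rewrite monicE lead_coefDl // lead_coefXn size_polyDl // size_polyXn.
have sG' : (size (G - 'X^n)%R <= n)%N.
  have lG : G`_n = 1 by move/monicP: Gm; rewrite lead_coefE sG.
  apply/leq_sizeP => j; rewrite leq_eqVlt coefB coefXn => /predU1P[<-|nj].
    by rewrite eqxx lG subrr.
  by rewrite nth_default ?sG // gtn_eqF // subrr.
by exists (npolyp n (G - 'X^n)); rewrite // npolypK // addrC subrK.
Qed.

Lemma uniq_monics n : uniq (monics n).
Proof.
rewrite map_inj_uniq ?enum_uniq // => p p' /addrI; exact: val_inj.
Qed.

Lemma size_monics n : size (monics n) = (#|F| ^ n)%N.
Proof. by rewrite size_map -cardE card_npoly. Qed.

Lemma count_monics_bij (n m : nat) (f : {poly F} -> {poly F})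
    (p p' : pred {poly F}) :
  {in monics m &, injective f} ->
  (forall G, G \in monics m -> p' G -> f G \in monics n /\ p (f G)) ->
  (forall H, H \in monics n -> p H ->
     exists G, [/\ G \in monics m, p' G & H = f G]) ->
  count p (monics n) = count p' (monics m).
Proof.
move=> finj fP fS.
rewrite -!size_filter -[RHS](size_map f); apply/perm_size/uniq_perm.
- by rewrite filter_uniq ?uniq_monics.
- rewrite map_inj_in_uniq ?filter_uniq ?uniq_monics // => x y.
  by rewrite !mem_filter => /andP[_ xm] /andP[_ ym]; apply: finj.
move=> H; rewrite mem_filter; apply/andP/mapP => [[pH Hn]|[G]].
  by have [G [Gm p'G ->]] := fS H Hn pH; exists G; rewrite // mem_filter p'G.
by rewrite mem_filter => /andP[p'G Gm] ->; have [] := fP G Gm p'G.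
Qed.

(** Multiplication by [H] is a bijection from the monic cofactors, of degree [n - deg H], to the
    monic multiples of degree [n]. *)
Lemma count_dvdp_monics (H : {poly F}) n (p : pred {poly F}) : H \is monic ->
  count (fun G => (H %| G) && p G) (monics n) =
  if ((size H).-1 <= n)%N
  then count (fun G => p (H * G)) (monics (n - (size H).-1)) else 0%N.
Proof.
move=> Hm; have H0 := monic_neq0 Hm.
have sH : size H = (size H).-1.+1 by rewrite prednK // size_poly_gt0.
case: leqP => [le_Hn|lt_nH].
  apply: (@count_monics_bij _ _ (fun G => H * G)).
  - by move=> G G' _ _; apply: mulfI.
  - move=> G; rewrite !mem_monics => /andP[Gm /eqP sG] pG.
    rewrite monicMl // Gm size_proper_mul; last first.
      by rewrite (monicP Hm) (monicP Gm) mulr1 oner_neq0.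
    by rewrite dvdp_mulr // sG sH addSn addnS /= subnKC.
  - move=> G; rewrite mem_monics => /andP[Gm /eqP sG] /andP[/dvdpP[K eG] pG].
    exists K; rewrite mulrC -eG pG; split=> //.
    move: Gm sG; rewrite eG monicMr // mem_monics => Km.
    rewrite Km size_proper_mul; last first.
      by rewrite (monicP Hm) (monicP Km) mulr1 oner_neq0.
    rewrite sH addnS /= => sK.
    by move: sK; rewrite -(@subnKC (size H).-1 n) // addKn addnC -addnS => /addnI ->.
apply/eqP; rewrite eqn0Ngt -has_count -all_predC; apply/allP => G.
rewrite mem_monics => /andP[Gm /eqP sG] /=; rewrite negb_and; apply/orP; left.
apply/negP => /dvdp_leq; rewrite monic_neq0 // sG sH => /(_ isT).
by rewrite ltnS leqNgt lt_nH.
Qed.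

Definition all_roots : {poly F} := \prod_(x : F) ('X - x%:P).

Lemma size_prod_roots (Z : {set F}) :
  size (\prod_(x in Z) ('X - x%:P) : {poly F}) = #|Z|.+1.
Proof. by rewrite -big_enum size_prod_XsubC cardE. Qed.

Lemma monic_prod_roots (Z : {set F}) :
  (\prod_(x in Z) ('X - x%:P) : {poly F}) \is monic.
Proof. exact: monic_prod_XsubC. Qed.

Lemma all_rootsE : all_roots = \prod_(x in [set: F]%SET) ('X - x%:P).
Proof. by apply: eq_bigl => x; rewrite finset.inE. Qed.

Lemma prod_roots_dvd (Z : {set F}) G : (forall x, x \in Z -> root G x) ->
  \prod_(x in Z) ('X - x%:P) %| G.
Proof.
move=> GZ; rewrite -big_enum; apply: uniq_roots_dvdp.
  by apply/allP => x; rewrite mem_enum => /GZ.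
by rewrite uniq_rootsE enum_uniq.
Qed.

(** Otherwise the product of all [X - x], of degree q, would divide a nonzero polynomial of smaller
    degree. *)
Lemma vanishing_eq0 G : (size G <= #|F|)%N -> (forall x, G.[x] = 0) -> G = 0.
Proof.
move=> sG G0; apply/eqP; case: eqP => // /eqP nzG.
have := @prod_roots_dvd [set: F]%SET G.
move/(_ _)/dvdp_leq; rewrite nzG size_prod_roots cardsT ltnNge sG.
by apply=> // x _; apply/rootP.
Qed.

(** Evaluation is injective on polynomials of degree less than q, and there are q^q of them, as many
    as functions on F; hence it is onto. *)
Lemma interpolation (b : F -> F) :
  exists2 r : {poly F}, (size r <= #|F|)%N & forall x, r.[x] = b x.
Proof.
pose ev (p : {poly_#|F| F}) : {ffun F -> F} := [ffun x => (p : {poly F}).[x]].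
have ev_inj : injective ev.
  move=> p p' /ffunP epp'; apply/val_inj/eqP; rewrite -subr_eq0; apply/eqP.
  apply: vanishing_eq0 => [|x]; last first.
    by have := epp' x; rewrite !ffunE !hornerE => ->; rewrite subrr.
  by rewrite (leq_trans (size_polyD _ _)) // size_polyN geq_max !size_npoly.
have [|p ep] := codomP (inj_card_onto ev_inj _ (finfun b)).
  by rewrite card_npoly card_ffun.
exists p; rewrite ?size_npoly // => x.
by have /ffunP/(_ x) := ep; rewrite !ffunE.
Qed.

(** The solutions are the [all_roots * H + r], with [r] an interpolant of [b] and [H] any monic
    polynomial of degree n - q. *)
Lemma count_values_large (b : F -> F) n : (#|F| <= n)%N ->
  count (fun G => [forall x, G.[x] == b x]) (monics n) = (#|F| ^ (n - #|F|))%N.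
Proof.
move=> le_qn; have [r sr rb] := interpolation b.
have sW : size all_roots = #|F|.+1 by rewrite all_rootsE size_prod_roots cardsT.
have Wm : all_roots \is monic by rewrite all_rootsE monic_prod_roots.
have W0 x : all_roots.[x] = 0.
  by rewrite horner_prod (bigD1 x) //= !hornerE subrr mul0r.
rewrite -size_monics -count_predT.
apply: (@count_monics_bij _ _ (fun H => all_roots * H + r)).
- by move=> H H' _ _ /addIr; apply: mulfI; apply: monic_neq0.
- move=> H; rewrite !mem_monics => /andP[Hm /eqP sH] _.
  have sWH : size (all_roots * H) = n.+1.
    rewrite size_proper_mul ?sW ?sH; last first.
      by rewrite (monicP Hm) (monicP Wm) mulr1 oner_neq0.
    by rewrite addSn addnS /= subnKC.
  have lt_r : (size r < size (all_roots * H)%R)%N by rewrite sWH ltnS (leq_trans sr).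
  rewrite monicE lead_coefDl // -monicE monicMl // Hm size_polyDl // sWH eqxx.
  by split=> //; apply/forallP => x; rewrite !hornerE W0 mul0r add0r rb.
- move=> G; rewrite mem_monics => /andP[Gm /eqP sG] /forallP Gb.
  have /dvdpP[H eH] : all_roots %| G - r.
    rewrite all_rootsE; apply: prod_roots_dvd => x _.
    by apply/rootP; rewrite !hornerE rb (eqP (Gb x)) subrr.
  have lt_r : (size r < size G)%N by rewrite sG ltnS (leq_trans sr).
  have GrM : G - r \is monic by rewrite monicE lead_coefDl ?size_polyN // -monicE.
  have sGr : size (G - r) = n.+1 by rewrite size_polyDl ?size_polyN.
  exists H; rewrite mulrC -eH subrK; split=> //.
  move: GrM sGr; rewrite eH monicMr // mem_monics => Hm.
  rewrite Hm size_proper_mul ?sW; last first.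
    by rewrite (monicP Hm) (monicP Wm) mulr1 oner_neq0.
  rewrite addnS /= -{1}(subnKC le_qn) addnC -addnS => /addnI ->.
  exact: eqxx.
Qed.

(** The difference of two solutions vanishes on F and has size at most n + 1 <= q, so it is 0. *)
Lemma count_values_small (b : F -> F) n : (n < #|F|)%N ->
  (count (fun G => [forall x, G.[x] == b x]) (monics n) <= 1)%N.
Proof.
move=> lt_nq; rewrite leqNgt -size_filter; apply/negP.
set s := seq.filter _ _ => s2.
have us : uniq s by rewrite filter_uniq ?uniq_monics.
have s0 : (0 < size s)%N by apply: ltnW.
have := nth_uniq 0 s0 s2 us.
suff -> : s`_0 = s`_1 by rewrite eqxx.
have := mem_nth 0 s0; have := mem_nth 0 s2.
move: (s`_0) (s`_1) => G H.
rewrite !mem_filter !mem_monics => /andP[/forallP Hb /andP[_ /eqP sH]].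
move=> /andP[/forallP Gb /andP[_ /eqP sG]].
apply/eqP; rewrite -subr_eq0; apply/eqP/vanishing_eq0 => [|x].
  by rewrite (leq_trans (size_polyD _ _)) // size_polyN sG sH maxnn.
by rewrite !hornerE (eqP (Hb x)) (eqP (Gb x)) subrr.
Qed.

End MonicPolynomials.

(** * The sieve over sets of irreducibles *)

Lemma prod_one_sub (K : comPzRingType) (T : finType) (A : {set T}) (f : T -> K) :
  \prod_(P in A) (1 - f P) =
  \sum_(J in powerset A) (-1) ^+ #|J| * \prod_(P in J) f P.
Proof.
rewrite big_mkcond /=.
(* A factor outside [A] becomes 0 + 1, so that the product over the whole type can be expanded and
   only the subsets of [A] survive. *)
rewrite (eq_bigr (fun P => (if P \in A then - f P else 0) + 1)); last first.
  by move=> P _; case: ifP => _; rewrite ?add0r // addrC.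
rewrite bigA_distr [RHS]big_mkcond; apply: eq_bigr => J _.
rewrite powersetE; case: ifP => [/fintype.subsetP sJA|/negbT/fintype.subsetPn[P PJ PA]].
  rewrite -prodrN [RHS]big_mkcond; apply: eq_bigr => P _.
  by case: ifP => // /sJA ->.
by rewrite (bigD1 P) //= PJ (negPf PA) mul0r.
Qed.

Section IrreducibleSieve.
Variables (F : finFieldType) (D : nat).
Local Notation T := {poly_(D.+1) F}.
Implicit Types (J A : {set T}) (G : {poly F}).

(** The cap [D] on the degree makes this a finite set; it is always taken at least as large as the
    degree of the polynomials being sieved. *)
Definition irreds : {set T} :=
  [set P : T | ((P : {poly F}) \is monic) && irreducibleb (P : {poly F})]%SET.

Definition setprod J : {poly F} := \prod_(P in J) (P : {poly F}).
Definition setdeg J : nat := (size (setprod J)).-1.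

Lemma irreds_monic (P : T) : P \in irreds -> (P : {poly F}) \is monic.
Proof. by rewrite finset.inE => /andP[]. Qed.

Lemma irreds_irr (P : T) : P \in irreds -> irreducible_poly (P : {poly F}).
Proof. by rewrite finset.inE => /andP[_ /irreducibleP]. Qed.

Lemma irreds_coprime (P Q : T) : P \in irreds -> Q \in irreds ->
  coprimep (P : {poly F}) (Q : {poly F}) = (P != Q).
Proof.
move=> PI QI; rewrite irreducible_poly_coprime; last exact: irreds_irr.
congr (~~ _); apply/idP/eqP => [dPQ|-> //].
have sP : size (P : {poly F}) != 1%N.
  by have [] := irreds_irr PI; case: (size _) => [|[]].
have := apply_irredp (irreds_irr QI) sP dPQ.
by rewrite eqp_monic ?irreds_monic // => /eqP /val_inj.
Qed.

Lemma setprod_monic J : J \subset irreds -> setprod J \is monic.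
Proof.
move=> /fintype.subsetP sJ; apply: monic_prod => P /sJ; exact: irreds_monic.
Qed.

(** Distinct monic irreducibles are coprime, and so are their powers, so Gauss's lemma applies one
    factor at a time. *)
Lemma dvdp_setprod_exp k J G : J \subset irreds ->
  (setprod J ^+ k %| G) = [forall P in J, (P : {poly F}) ^+ k %| G].
Proof.
move=> /fintype.subsetP sJ; rewrite /setprod -big_enum.
have -> : [forall P in J, (P : {poly F}) ^+ k %| G] =
          all (fun P : T => (P : {poly F}) ^+ k %| G) (enum J).
  by apply/forall_inP/allP => dG P PJ; apply: dG; rewrite mem_enum in PJ *.
have : all [in irreds] (enum J) by apply/allP => P; rewrite mem_enum => /sJ.
elim: (enum J) (enum_uniq J) => [|P s IHs] /=; first by rewrite big_nil expr1n dvd1p.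
move=> /andP[Ps us] /andP[PI sI]; rewrite big_cons exprMn Gauss_dvdp ?IHs //.
apply/coprimep_expl/coprimep_expr; rewrite big_seq.
apply: (big_ind (fun h => coprimep (P : {poly F}) h)) => [|x y cx cy|Q Qs]; first exact: coprimep1.
  by rewrite coprimepMr cx cy.
rewrite irreds_coprime // ?(allP sI) //.
by apply: contraNneq Ps => ->.
Qed.

Lemma mem_of_dvdp_setprod (P : T) J : J \subset irreds -> P \in irreds ->
  (P : {poly F}) %| setprod J -> P \in J.
Proof.
move=> /fintype.subsetP sJ PI; apply: contraTT => PJ.
rewrite -irreducible_poly_coprime; last exact: irreds_irr.
apply: (big_ind (fun h => coprimep (P : {poly F}) h)) => [|x y cx cy|Q QJ]; first exact: coprimep1.
  by rewrite coprimepMr cx cy.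
by rewrite irreds_coprime // ?sJ //; apply: contraNneq PJ => ->.
Qed.

(** Unique factorisation: [J] is recovered as the set of irreducible divisors of its product. *)
Lemma setprod_inj : {in powerset irreds &, injective setprod}.
Proof.
have sub J J' : J \subset irreds -> J' \subset irreds ->
    setprod J = setprod J' -> J \subset J'.
  move=> sJ sJ' e; apply/fintype.subsetP => P PJ.
  apply: (mem_of_dvdp_setprod sJ'); first exact: (fintype.subsetP sJ).
  rewrite -e /setprod (bigD1 P) //=; exact: dvdp_mulr.
move=> J J'; rewrite !powersetE => sJ sJ' e.
apply/eqP; rewrite finset.eqEsubset (sub J J' sJ sJ' e).
exact: (sub J' J sJ' sJ (esym e)).
Qed.

(** Expansion of the product of the 1 - [P^k | G]. The case k = 1 detects constants, the case k = 2
    square-free polynomials. *)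
Lemma sieve_indicator (K : comPzRingType) k A G : A \subset irreds ->
  [forall P in A, ~~ ((P : {poly F}) ^+ k %| G)%R]%:R =
  \sum_(J in powerset A) (-1) ^+ #|J| * (setprod J ^+ k %| G)%R%:R :> K.
Proof.
move=> sA; transitivity (\prod_(P in A) (1 - ((P : {poly F}) ^+ k %| G)%R%:R : K)).
  case: forall_inP => [nd|/forall_inP].
    by rewrite big1 // => P /nd/negPf ->; rewrite subr0.
  rewrite negb_forall_in => /exists_inP[P PA]; rewrite negbK => dP.
  by rewrite (bigD1 P) //= dP subrr mul0r.
rewrite prod_one_sub; apply: eq_bigr => J; rewrite powersetE => sJ.
congr (_ * _); rewrite dvdp_setprod_exp; last exact: fintype.subset_trans sA.
case: forall_inP => [dv|/forall_inP].
  by rewrite big1 // => P /dv ->.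
rewrite negb_forall_in => /exists_inP[P PJ /negPf nd].
by rewrite (bigD1 P) //= nd mul0r.
Qed.

Lemma card_setdeg j A : A \subset irreds ->
  (#|[set J in powerset A | setdeg J == j]%SET| <= #|F| ^ j)%N.
Proof.
move=> sA; rewrite -size_monics cardE -(size_map setprod).
have sub J : J \in enum [set J in powerset A | setdeg J == j]%SET ->
    J \subset irreds /\ setdeg J = j.
  rewrite mem_enum finset.inE powersetE => /andP[sJ /eqP ->]; split=> //.
  exact: fintype.subset_trans sA.
apply: uniq_leq_size.
  rewrite map_inj_in_uniq ?enum_uniq // => J J' /sub[sJ _] /sub[sJ' _].
  by apply: setprod_inj; rewrite powersetE.
move=> G /mapP[J /sub[sJ dJ] ->]; rewrite mem_monics setprod_monic //=.
by rewrite -dJ prednK // size_poly_gt0 monic_neq0 // setprod_monic.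
Qed.

(** A nonconstant divisor of least size is irreducible; dividing by its leading coefficient makes it
    monic. *)
Lemma irreducible_divisor G : (1 < size G <= D.+1)%N ->
  exists2 P : T, P \in irreds & (P : {poly F}) %| G.
Proof.
move=> /andP[G1 GD].
have exg : exists n, [exists g : T, (size (g : {poly F}) == n) &&
    [&& (1 < size (g : {poly F}))%N & (g : {poly F}) %| G]].
  exists (size G); apply/existsP; exists (npolyp D.+1 G).
  by rewrite npolypK // eqxx G1 dvdpp.
case: (ex_minnP exg) => n /existsP[g /and3P[/eqP sg g1 gG]] gmin.
have g0 : (g : {poly F}) != 0 by rewrite -size_poly_gt0 ltnW.
have lg0 : lead_coef (g : {poly F}) != 0 by rewrite lead_coef_eq0.
pose P : {poly F} := (lead_coef (g : {poly F}))^-1 *: (g : {poly F}).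
have eqPg : P %= (g : {poly F}) by rewrite eqp_scale // invr_eq0.
have sP : (size P <= D.+1)%N by rewrite (eqp_size eqPg) size_npoly.
have nP : npolyp D.+1 P = P :> {poly F} by rewrite npolypK.
exists (npolyp D.+1 P); last by rewrite nP (eqp_dvdl _ eqPg).
rewrite finset.inE nP; apply/andP; split.
  by rewrite monicE lead_coefZ mulVf.
apply/irreducibleP; split; first by rewrite (eqp_size eqPg).
move=> h h1 hP; have hg : h %| (g : {poly F}) by rewrite -(eqp_dvdr _ eqPg).
have sh : (size h <= size (g : {poly F}))%N by apply: dvdp_leq.
have h0 : (0 < size h)%N.
  rewrite size_poly_gt0; apply: contraTneq hg => ->; by rewrite dvd0p.
have h2 : (1 < size h)%N by move: h0 h1; case: (size h) => [|[]].
have shD : (size h <= D.+1)%N by rewrite (leq_trans sh) ?size_npoly.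
rewrite -dvdp_size_eqp // (eqp_size eqPg) eqn_leq sh sg; apply: gmin.
apply/existsP; exists (npolyp D.+1 h); rewrite npolypK // eqxx h2.
exact: dvdp_trans gG.
Qed.

End IrreducibleSieve.

Lemma irreds_linear (F : finFieldType) D (x : F) : (0 < D)%N ->
  npolyp D.+1 ('X - x%:P) \in irreds F D.
Proof.
move=> D0; rewrite finset.inE npolypK ?size_XsubC // monicXsubC.
by apply/irreducibleP/irredp_XsubC.
Qed.

(** * Möbius coefficients and the number of square-free polynomials *)

Section SieveCounting.
Variables (F : finFieldType) (K : realFieldType) (D : nat).
Local Notation T := {poly_(D.+1) F}.
Local Notation q := (#|F|%:R : K).
Implicit Types (J A : {set T}) (G : {poly F}).

Lemma count_sieve k n A (p : pred {poly F}) : A \subset irreds F D ->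
  (count (fun G => [forall P in A, ~~ ((P : {poly F}) ^+ k %| G)] && p G)
     (monics F n))%:R =
  \sum_(J in powerset A) (-1) ^+ #|J| *
    (count (fun G => (setprod J ^+ k %| G) && p G) (monics F n))%:R :> K.
Proof.
move=> sA.
have cE (p' : pred {poly F}) : (count (fun G => p' G && p G) (monics F n))%:R =
    \sum_(G <- monics F n | p G) (p' G)%:R :> K.
  rewrite -sum1_count big_mkcondl natr_sum.
  by apply: eq_bigr => G _; case: (p' G).
rewrite cE; under [RHS]eq_bigr do rewrite cE big_distrr.
rewrite exchange_big; apply: eq_bigr => G _.
exact: sieve_indicator.
Qed.

Lemma count_sieve_dvdp k n J : J \subset irreds F D ->
  (count (fun G => (setprod J ^+ k %| G) && true) (monics F n))%:R =
  (if (setdeg J * k <= n)%N then q ^+ (n - setdeg J * k) else 0) :> K.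
Proof.
move=> sJ; rewrite (@count_dvdp_monics F (setprod J ^+ k) n xpredT); last first.
  by rewrite monic_exp // setprod_monic.
by rewrite size_exp; case: ifP => // _; rewrite count_predT size_monics natrX.
Qed.

(** Grouping by degree. Vanishing is asked only at degrees that occur, which covers both an [f] of
    bounded support and a [B] above all degrees. *)
Lemma sum_setdeg A B (g : {set T} -> K) (f : nat -> K) :
  (forall j, (B <= j)%N -> (exists2 J : {set T}, J \subset A & setdeg J = j) -> f j = 0) ->
  \sum_(J in powerset A) g J * f (setdeg J) =
  \sum_(0 <= j < B) (\sum_(J in powerset A | setdeg J == j) g J) * f j.
Proof.
move=> fB; under [RHS]eq_bigr do rewrite big_distrl /= big_mkcondr /=.
rewrite exchange_big /=; apply: eq_bigr => J; rewrite powersetE => sJ.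
have -> : \sum_(0 <= j < B) (if setdeg J == j then g J * f j else 0) =
    \sum_(0 <= j < B | j == setdeg J) g J * f j.
  by rewrite [RHS]big_mkcond; apply: eq_bigr => j _; rewrite eq_sym.
rewrite big_nat1_eq /=; case: ltnP => // leB.
by rewrite fB ?mulr0 //; exists J.
Qed.

(** For [A = irreds F D] and j <= D this is the sum of the Möbius function over monic polynomials of
    degree j, the coefficient of u^j in the inverse zeta function of F[X]. *)
Definition mobius_coef A j : K :=
  \sum_(J in powerset A | setdeg J == j) (-1) ^+ #|J|.

Lemma mobius_coef_le A j : A \subset irreds F D -> `|mobius_coef A j| <= q ^+ j.
Proof.
move=> sA; apply: (le_trans (ler_norm_sum _ _ _)).
under eq_bigr do rewrite normrX normrN1 expr1n.
rewrite sumr_const -natrX ler_nat.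
apply: leq_trans (card_setdeg j sA).
by apply/subset_leq_card/fintype.subsetP => J; rewrite unfold_in => JA; rewrite finset.inE.
Qed.

(** The sieve with k = 1 counts monic polynomials of degree n without irreducible factor: only the
    constant 1 qualifies. *)
Lemma convolution_mobius_coef n : (n <= D)%N ->
  \sum_(0 <= j < n.+1) mobius_coef (irreds F D) j * q ^+ (n - j) =
  (n == 0)%N%:R.
Proof.
move=> nD.
pose f j : K := if (j <= n)%N then q ^+ (n - j) else 0.
transitivity (\sum_(0 <= j < n.+1) mobius_coef (irreds F D) j * f j).
  by apply: eq_big_nat => j /andP[_ jn]; rewrite /f -ltnS jn.
rewrite -sum_setdeg; last by move=> j nj _; rewrite /f leqNgt nj.
have := @count_sieve 1 n (irreds F D) xpredT (fintype.subxx _).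
under [X in _ = X -> _]eq_bigr => J JI.
  rewrite count_sieve_dvdp; last by rewrite powersetE in JI.
  rewrite muln1 -/(f (setdeg J)); over.
move=> <-; congr _%:R.
under eq_in_count => G.
  rewrite mem_monics => /andP[Gm /eqP sG].
  have -> : [forall P in irreds F D, ~~ ((P : {poly F}) ^+ 1 %| G)] && true = (n == 0)%N.
    rewrite andbT; apply/forall_inP/eqP => [nd|n0 P PI].
      apply/eqP; rewrite -leqn0 leqNgt; apply/negP => n0.
      have [|P PI dP] := @irreducible_divisor F D G; first by rewrite sG !ltnS n0.
      by have := nd P PI; rewrite expr1 dP.
    apply/negP; rewrite expr1 => /dvdp_leq; rewrite monic_neq0 // sG n0 => /(_ isT).
    by have [] := irreds_irr PI; rewrite ltnNge => /negPf ->.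
  over.
by case: eqP => [->|_]; rewrite ?count_predT ?count_pred0 // size_monics.
Qed.

(** The inverse zeta function is 1 - q u. *)
Lemma mobius_coefE n : (n <= D)%N ->
  mobius_coef (irreds F D) n =
  (if n is n'.+1 then if n' is 0%N then - q else 0 else 1).
Proof.
case: n => [|n] nD.
  by have := convolution_mobius_coef nD; rewrite big_nat1 mulr1.
have /eqP := convolution_mobius_coef nD.
rewrite big_nat_recr //= subnn mulr1.
(* The terms below the top one add up to q times the convolution sum of the preceding degree, which
   is 1 or 0. *)
rewrite (@eq_big_nat _ _ _ _ _ _
   (fun j => q * (mobius_coef (irreds F D) j * q ^+ (n - j)))); last first.
  by move=> j /andP[_ jn]; rewrite subSn // exprS mulrCA.
rewrite -big_distrr /= convolution_mobius_coef; last exact: ltnW.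
rewrite addrC addr_eq0 => /eqP ->.
by case: n {nD} => [|n]; rewrite ?mulr1 // mulr0 oppr0.
Qed.

Lemma square_free_irreds n G : (n <= D)%N -> G \in monics F n ->
  `[< square_free G >] = [forall P in irreds F D, ~~ ((P : {poly F}) ^+ 2 %| G)].
Proof.
move=> nD; rewrite mem_monics => /andP[Gm /eqP sG].
apply/asboolP/forall_inP => [sf P PI|sf g g1].
  by apply: sf; have [] := irreds_irr PI.
apply/negP => dg.
have sg : (size g <= D.+1)%N.
  apply: (@leq_trans (size G)); last by rewrite sG ltnS.
  apply: dvdp_leq; first exact: monic_neq0.
  by apply: dvdp_trans dg; rewrite expr2 dvdp_mulr.
have [|P PI dP] := @irreducible_divisor F D g; first by rewrite g1.
by have /negP := sf P PI; apply; apply: dvdp_trans dg; apply: dvdp_exp2r.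
Qed.

End SieveCounting.

(** In the sieve with k = 2 only degrees 0 and 1 have a nonzero coefficient, leaving q^d - q
    q^(d-2). *)
Lemma count_square_free (F : finFieldType) (K : realFieldType) d : (2 <= d)%N ->
  (count (fun G => `[< square_free G >]) (monics F d))%:R =
  #|F|%:R ^+ d * (1 - #|F|%:R^-1) :> K.
Proof.
move=> d2; set q : K := #|F|%:R.
have q0 : q != 0 by rewrite pnatr_eq0 -lt0n (ltn_trans _ (card_finNzRing_gt1 F)).
have /(congr1 (fun n => n%:R : K)) :
    count (fun G => `[< square_free G >]) (monics F d) =
    count (fun G => [forall P in irreds F d, ~~ ((P : {poly F}) ^+ 2 %| G)] && true)
      (monics F d).
  by apply: eq_in_count => G GM; rewrite andbT (@square_free_irreds F d d).
move=> ->; rewrite (@count_sieve F K d 2 d _ xpredT) //.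
pose f j : K := if (j * 2 <= d)%N then q ^+ (d - j * 2) else 0.
rewrite (eq_bigr (fun J : {set {poly_d.+1 F}} => (-1) ^+ #|J| * f (setdeg J))); last first.
  by move=> J; rewrite powersetE => sJ; rewrite count_sieve_dvdp.
rewrite (@sum_setdeg F K d _ d.+1); last first.
  by move=> j dj _; rewrite /f ifN // -ltnNge (leq_trans dj) // leq_pmulr.
rewrite (@eq_big_nat _ _ _ _ _ _ (fun j => mobius_coef K (irreds F d) j * f j)) //.
rewrite big_ltn // big_ltn ?ltnS ?(ltnW d2) // big_nat_cond big1 ?addr0; last first.
  move=> j /andP[/andP[j2 jd] _]; rewrite mobius_coefE //.
  by case: j j2 {jd} => [|[|j]] // _; rewrite mul0r.
rewrite !mobius_coefE ?(ltnW d2) // /f /= d2 mul0n subn0 mul1r mul1n.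
have -> : q ^+ d = q ^+ (d - 2) * (q * q) by rewrite -expr2 -exprD subnK.
by field.
Qed.

Lemma card_sqfree_monic (F : finFieldType) d (p : pred {poly F}) :
  #|[set f in sqfree_monic F d | p f]%SET| =
  count (fun G => `[< square_free G >] && p G) (monics F d).
Proof.
rewrite -size_filter cardE -(size_map (fun f : {poly_(d.+1) F} => (f : {poly F}))).
apply/perm_size/uniq_perm.
- by rewrite map_inj_uniq ?enum_uniq //; apply: val_inj.
- by rewrite filter_uniq ?uniq_monics.
move=> G; rewrite mem_filter mem_monics; apply/mapP/idP => [[f + ->]|].
  by rewrite mem_enum !finset.inE => /andP[/and3P[-> -> ->] ->].
case/andP => /andP[sf pG] /andP[Gm sG].
have nG : npolyp d.+1 G = G :> {poly F} by rewrite npolypK // (eqP sG).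
by exists (npolyp d.+1 G); rewrite // mem_enum !finset.inE nG sf pG Gm sG.
Qed.

(** * The Euler product over nonlinear irreducibles *)

(** The constant is 1 / (1 - 1/q) at q = 3. *)
Lemma geometric_sum_le (K : realFieldType) (q : K) k : 3 <= q ->
  \sum_(0 <= j < k.+1) q ^+ j <= 3 / 2 * q ^+ k.
Proof.
move=> q3; elim: k => [|k IHk]; first by rewrite big_nat1; lra.
rewrite big_nat_recr //= exprS.
have q0 : 0 <= q by lra.
have := exprn_ge0 k q0.
move: (q ^+ k) IHk => x h x0; nra.
Qed.

Lemma geometric_tail_le (K : realFieldType) (q : K) k B : 3 <= q ->
  \sum_(k.+1 <= j < B) q ^- j <= q ^- k / 2.
Proof.
move=> q3; have q0 : 0 < q by lra.
have qx n : q ^- n = q * q ^- n.+1.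
  by rewrite exprS invfM mulVKf // gt_eqF.
have [Bk|] := leqP B k.+1.
  by rewrite big_geq // divr_ge0 // invr_ge0 exprn_ge0 // ltW.
(* Keeping the subtracted term makes the bound on the partial sums provable by induction. *)
suff le_diff n :
    \sum_(k.+1 <= j < (n + k).+1) q ^- j <= (q ^- k - q ^- (n + k)) / 2.
  move=> /ltnW/subnK <-; rewrite addnS; apply: le_trans (le_diff _) _.
  by rewrite ler_wpM2r // lerBlDr lerDl invr_ge0 exprn_ge0 // ltW.
elim: n => [|n IHn]; first by rewrite big_geq // add0n subrr mul0r.
rewrite addSn big_nat_recr ?ltnS ?leq_addl //=.
have := qx (n + k)%N; have : 0 <= q ^- (n + k).+1.
  by rewrite invr_ge0 exprn_ge0 // ltW.
move: (q ^- (n + k).+1) (q ^- (n + k)) (q ^- k) (\sum_(_ <= _ < _) _) IHn.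
move=> x y z S h x0 e; nra.
Qed.

Section PrescribedValues.
Variables (F : finFieldType) (K : realFieldType).
Hypothesis q3 : (3 <= #|F|)%N.
Local Notation q := (#|F|%:R : K).

Let q3K : 3 <= q. Proof. by rewrite (ler_nat K 3). Qed.
Let q_gt0 : 0 < q. Proof. exact: lt_le_trans q3K. Qed.

(** Bernoulli's inequality gives the lower bound 1 - q q^-2 = 1 - 1/q. *)
Lemma bernoulli_density : 2 / 3 <= (1 - q ^- 2) ^+ #|F| <= 1.
Proof.
have q3' := q3K; have v0 : 0 <= q ^- 2 by rewrite invr_ge0 exprn_ge0 // ltW.
have v1 : q ^- 2 <= 1 by rewrite invf_le1 ?exprn_gt0 // exprn_ege1 //; lra.
have iq : q^-1 <= 1 / 3 by rewrite div1r lef_pV2 ?posrE.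
have bern n : 1 - n%:R * q ^- 2 <= (1 - q ^- 2) ^+ n.
  elim: n => [|n IHn]; first by rewrite mul0r subr0 expr0.
  rewrite [_ ^+ n.+1]exprS -natr1; have : 0 <= n%:R :> K by [].
  move: (q ^- 2) ((_ - _) ^+ n) (n%:R : K) v0 v1 IHn => v x m v0 v1 h m0.
  have h1 : 0 <= (1 - v) * (x - (1 - m * v)) by rewrite mulr_ge0 ?subr_ge0.
  have h2 : 0 <= m * (v * v) by rewrite !mulr_ge0.
  nra.
rewrite exprn_ile1 ?subr_ge0 ?lerBlDr ?lerDl //.
rewrite andbT; apply: le_trans (bern _).
have -> : q * q ^- 2 = q^-1 by rewrite expr2; field; rewrite gt_eqF.
by lra.
Qed.

Variable D : nat.
Hypothesis D0 : (0 < D)%N.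
Local Notation T := {poly_(D.+1) F}.

Definition linears : {set T} := [set npolyp D.+1 ('X - x%:P) | x : F]%SET.

Let linearsK (x : F) : npolyp D.+1 ('X - x%:P) = 'X - x%:P :> {poly F}.
Proof. by rewrite npolypK // size_XsubC. Qed.

Lemma linears_sub : linears \subset irreds F D.
Proof. by apply/fintype.subsetP => P /imsetP[x _ ->]; apply: irreds_linear. Qed.

Definition nonlinears : {set T} := (irreds F D :\: linears)%SET.

Lemma nonlinears_sub : nonlinears \subset irreds F D.
Proof. exact: subsetDl. Qed.

(** A zero at [x] would put [X - x] in [J]. Thanks to this, prescribed values can be divided by
    those of [setprod J ^+ 2]. *)
Lemma setprod_nonlinears_neq0 (J : {set T}) (x : F) : J \subset nonlinears ->
  (setprod J).[x] != 0.
Proof.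
move=> sJ; apply/negP => rx.
have dx : (npolyp D.+1 ('X - x%:P) : {poly F}) %| setprod J.
  by rewrite linearsK dvdp_XsubCl.
have sJ' := fintype.subset_trans sJ nonlinears_sub.
have := fintype.subsetP sJ _ (mem_of_dvdp_setprod sJ' (irreds_linear x D0) dx).
by rewrite finset.inE imset_f.
Qed.

Lemma setdegE (J : {set T}) : J \subset irreds F D ->
  setdeg J = (\sum_(P in J) (size (P : {poly F})).-1)%N.
Proof.
move=> /fintype.subsetP sJ; rewrite /setdeg /setprod size_prod; last first.
  by move=> P /sJ PI; rewrite monic_neq0 // irreds_monic.
have <- : (\sum_(P in J) (size (P : {poly F})).-1 + #|J| =
    \sum_(P in J) size (P : {poly F}))%N.
  rewrite -sum1_card -big_split; apply: eq_bigr => P /sJ PI.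
  by rewrite /= addn1 prednK // size_poly_gt0 monic_neq0 // irreds_monic.
by rewrite -addSn addnK.
Qed.

Lemma euler_product (A : {set T}) (v : K) : A \subset irreds F D ->
  \sum_(J in powerset A) (-1) ^+ #|J| * v ^+ setdeg J =
  \prod_(P in A) (1 - v ^+ (size (P : {poly F})).-1).
Proof.
move=> sA; rewrite prod_one_sub; apply: eq_bigr => J; rewrite powersetE => sJ.
rewrite setdegE; last exact: fintype.subset_trans sA.
by rewrite expr_sum.
Qed.

Lemma euler_product_linears (v : K) :
  \prod_(P in linears) (1 - v ^+ (size (P : {poly F})).-1) = (1 - v) ^+ #|F|.
Proof.
rewrite big_imset /=; last first.
  move=> x y _ _ /(congr1 (fun p : T => (p : {poly F}))).
  by rewrite !linearsK => /addrI/oppr_inj/polyC_inj.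
rewrite (eq_bigr (fun _ => 1 - v)); last first.
  by move=> x _; rewrite linearsK size_XsubC expr1.
by rewrite prodr_const.
Qed.

(** At most q^j sets have degree j. The bound [B] is left existential because the sums on the right
    are later estimated uniformly in it. *)
Lemma sum_setdeg_le (A : {set T}) (f : nat -> K) : A \subset irreds F D ->
  (forall j, 0 <= f j) ->
  exists B, \sum_(J in powerset A) f (setdeg J) <= \sum_(0 <= j < B) q ^+ j * f j.
Proof.
move=> sA f0; pose B := (\max_(J in powerset A) setdeg J).+1; exists B.
pose f' j := if (j < B)%N then f j else 0.
rewrite (eq_bigr (fun J : {set T} => 1 * f' (setdeg J))); last first.
  by move=> J JA; rewrite mul1r /f' ltnS leq_bigmax_cond.
rewrite (@sum_setdeg F K D A B); last by move=> j Bj _; rewrite /f' ltnNge Bj.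
apply: ler_sum_nat => j /andP[_ jB]; rewrite /f' jB ler_wpM2r //.
rewrite sumr_const -natrX ler_nat; apply: leq_trans (card_setdeg j sA).
apply/subset_leq_card/fintype.subsetP => J.
by rewrite unfold_in => JA; rewrite finset.inE.
Qed.

(** Degrees up to [D] contribute exactly 1 - q q^-2; beyond [D] the coefficient of degree j is at
    most q^j, and its weight q^(-2j) leaves a geometric tail. *)
Lemma euler_product_irreds :
  `|\prod_(P in irreds F D) (1 - (q ^- 2) ^+ (size (P : {poly F})).-1)
    - (1 - q^-1)| <= q ^- D / 2.
Proof.
have sII := fintype.subxx (mem (irreds F D)).
rewrite -euler_product //.
(* [B] exceeds every degree that occurs, and also [D], so that the sum can be split there. *)
pose B := maxn D.+1 (\max_(J in powerset (irreds F D)) setdeg J).+1.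
rewrite (@sum_setdeg F K D _ B); last first.
  move=> j + [J JI dJ]; rewrite leqNgt -dJ leq_max ltnS.
  rewrite [X in _ || X]ltnS.
  by rewrite (@leq_bigmax_cond _ _ (@setdeg F D) J) ?orbT // powersetE.
have DB : (D.+1 <= B)%N by rewrite leq_maxl.
rewrite (@big_cat_nat _ _ _ D.+1) //=.
rewrite -!/(mobius_coef K (irreds F D) _).
under eq_bigr do rewrite -/(mobius_coef K (irreds F D) _).
under [X in _ + X - _]eq_bigr do rewrite -/(mobius_coef K (irreds F D) _).
have -> : \sum_(0 <= j < D.+1) mobius_coef K (irreds F D) j * (q ^- 2) ^+ j =
    1 - q^-1.
  rewrite big_ltn // big_ltn // big_nat_cond big1 ?addr0; last first.
    move=> j /andP[/andP[j2 jd] _]; rewrite mobius_coefE //.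
    by case: j j2 {jd} => [|[|j]] // _; rewrite mul0r.
  by rewrite !mobius_coefE //; field; rewrite gt_eqF.
rewrite addrAC subrr add0r.
apply: le_trans (geometric_tail_le D B q3K).
apply: (le_trans (ler_norm_sum _ _ _)); apply: ler_sum => j _.
have w0 : 0 <= (q ^- 2) ^+ j by rewrite exprn_ge0 // invr_ge0 exprn_ge0 // ltW.
rewrite normrM (ger0_norm w0).
have -> : q ^- j = q ^+ j * (q ^- 2) ^+ j.
  rewrite -exprVn -exprMn -exprVn expr2 mulVKf //; by rewrite gt_eqF.
by rewrite ler_wpM2r ?mobius_coef_le.
Qed.

(** Dividing out the linear factors, whose product is at least 2/3, multiplies the error q^-D / 2 by
    at most 3/2. *)
Lemma euler_product_nonlinears :
  `|\prod_(P in nonlinears) (1 - (q ^- 2) ^+ (size (P : {poly F})).-1)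
    - (1 - q^-1) / (1 - q ^- 2) ^+ #|F| | <= q ^- D.
Proof.
have := euler_product_irreds; have /andP[b1 b2] := bernoulli_density.
rewrite (big_setID linears) /= (finset.setIidPr linears_sub) euler_product_linears.
rewrite -/nonlinears.
have : 0 <= q ^- D by rewrite invr_ge0 exprn_ge0 // ltW.
move: (\prod_(P in nonlinears) _) (q ^- D) (q^-1) ((1 - q ^- 2) ^+ _) b1 b2.
move=> R y p B b1 b2 y0 le1; have B0 : 0 < B by lra.
have -> : R - (1 - p) / B = (B * R - (1 - p)) / B.
  by field; rewrite gt_eqF.
rewrite normrM normfV (gtr0_norm B0) ler_pdivrMr //.
by apply: le_trans le1 _; nra.
Qed.

End PrescribedValues.

(* Error made, for [deg (prod J) = j], when the number of admissible multiples of
   [(prod J)^2] is replaced by [q^(e - n - 2j)]; here [q] and [n] both stand for the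
   cardinality of the field.  The true number is 0 as soon as [2j > e]. *)
Definition sieve_error (K : realFieldType) (q : K) (n e j : nat) : K :=
  if (j <= e./2)%N then 1 else q ^+ e / q ^+ n * (q ^- 2) ^+ j.

Lemma sieve_error_ge0 (K : realFieldType) (q : K) n e j :
  0 < q -> 0 <= sieve_error q n e j.
Proof.
move=> q0; rewrite /sieve_error; case: ifP => // _.
by rewrite mulr_ge0 ?divr_ge0 ?exprn_ge0 ?invr_ge0 ?exprn_ge0 ?ltW.
Qed.

(** The constant is 3/2 + 1/2: a geometric sum up to [e./2] and a geometric tail after it. *)
Lemma sum_sieve_error_le (K : realFieldType) (q : K) n e B :
  3 <= q -> (0 < n)%N ->
  \sum_(0 <= j < B) q ^+ j * sieve_error q n e j <= 2 * q ^+ e./2.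
Proof.
move=> q3 n0; have q0 : 0 < q by lra.
have q1 : 1 <= q by lra.
have qX0 m : 0 < q ^+ m by rewrite exprn_gt0.
have E0 : 0 <= q ^+ e / q ^+ n by rewrite divr_ge0 ?ltW.
(* The range is enlarged so that it can be split after [e./2], whatever [B] is. *)
apply: (@le_trans _ _ (\sum_(0 <= j < B + (e./2).+1) q ^+ j * sieve_error q n e j)).
  rewrite [leRHS](@big_cat_nat _ _ _ B) ?leq_addr //= lerDl.
  by apply: sumr_ge0 => j _; rewrite mulr_ge0 ?sieve_error_ge0 // ltW.
rewrite (@big_cat_nat _ _ _ (e./2).+1) ?leq_addl //=.
have s1 : \sum_(0 <= j < (e./2).+1) q ^+ j * sieve_error q n e j <=
    3 / 2 * q ^+ e./2.
  apply: le_trans (geometric_sum_le _ q3).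
  by apply: ler_sum_nat => j /andP[_ je]; rewrite /sieve_error -ltnS je mulr1.
have s2 : \sum_((e./2).+1 <= j < B + (e./2).+1) q ^+ j * sieve_error q n e j <=
    q ^+ e / q ^+ n * (q ^- e./2 / 2).
  apply: (@le_trans _ _
    (\sum_((e./2).+1 <= j < B + (e./2).+1) q ^+ e / q ^+ n * q ^- j)).
    apply: ler_sum_nat => j /andP[je _]; rewrite /sieve_error leqNgt je /= mulrCA.
    have -> : (q ^- 2) ^+ j = q ^- j.*2 by rewrite -mul2n exprM exprVn.
    by rewrite -addnn exprD invfM mulVKf ?gt_eqF.
  by rewrite -big_distrr /= ler_wpM2l // geometric_tail_le.
(* Since e <= 2 [e./2] + 1, one factor q from [q ^+ n] absorbs the parity of [e]. *)
have s3 : q ^+ e / q ^+ n * q ^- e./2 <= q ^+ e./2.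
  rewrite -mulrA -invfM -exprD ler_pdivrMr // -exprD ler_weXn2l //.
  rewrite addnCA addnn -{1}(odd_double_half e) leq_add2r.
  exact: leq_trans (leq_b1 _) n0.
apply: (le_trans (lerD s1 s2)); rewrite mulrA.
by move: (q ^+ e./2) (_ * q ^- e./2) s3 => y z s3; clear - s3; lra.
Qed.

(** * Square-free polynomials with prescribed nonzero values *)

Section PrescribedCount.
Variables (F : finFieldType) (K : realFieldType).
Hypothesis q3 : (3 <= #|F|)%N.
Local Notation q := (#|F|%:R : K).

Let q3K : 3 <= q. Proof. by rewrite (ler_nat K 3). Qed.
Let q_gt0 : 0 < q. Proof. exact: lt_le_trans q3K. Qed.
Let q_ge1 : 1 <= q. Proof. by apply: le_trans q3K; rewrite (ler_nat K 1). Qed.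
Let qX_gt0 n : 0 < q ^+ n. Proof. by rewrite exprn_gt0. Qed.

(** For n >= q the difference is 0; for n < q both the count and q^(n-q) lie between 0 and 1. The
    quotient of powers allows n - q to be negative. *)
Lemma count_values_error (a : F -> F) (n e m : nat) : (m <= e./2)%N ->
  n = (e - m.*2)%N ->
  `|(count (fun G => [forall x, G.[x] == a x]) (monics F n))%:R
    - q ^+ e / q ^+ #|F| * (q ^- 2) ^+ m| <= 1.
Proof.
move=> le_me ->; have le_me2 : (m.*2 <= e)%N by rewrite -geq_half_double.
have -> : q ^+ e / q ^+ #|F| * (q ^- 2) ^+ m = q ^+ e / q ^+ (#|F| + m.*2).
  have -> : (q ^- 2) ^+ m = q ^- m.*2 by rewrite -mul2n exprM exprVn.
  by rewrite exprD invfM mulrA.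
have [le_qe|lt_eq] := leqP #|F| (e - m.*2).
  rewrite count_values_large // natrX.
  have {2}-> : e = (e - m.*2 - #|F| + (#|F| + m.*2))%N.
    by rewrite addnA (subnK le_qe) (subnK le_me2).
  by rewrite exprD mulfK ?gt_eqF // subrr normr0.
have := count_values_small a lt_eq; rewrite -(ler_nat K).
move: (count _ _) => c c1; have c0 := ler0n K c.
have y0 : 0 <= q ^+ e / q ^+ (#|F| + m.*2) by rewrite divr_ge0 ?ltW.
have y1 : q ^+ e / q ^+ (#|F| + m.*2) <= 1.
  rewrite ler_pdivrMr // mul1r ler_weXn2l //.
  by move: lt_eq; rewrite ltn_subLR // addnC => /ltnW.
move: (q ^+ e / _) y0 y1 => y y0 y1; clear - c0 c1 y0 y1.
by rewrite ler_norml; lra.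
Qed.

(** Dividing by [setprod J ^+ 2] turns the values [a] into other prescribed values; when its degree
    exceeds [e] there is no multiple and the main term is the whole error. *)
Lemma count_dvdp_values (D e : nat) (a : F -> F) (J : {set {poly_(D.+1) F}}) :
  (0 < D)%N -> J \subset nonlinears F D ->
  `|(count (fun G => (setprod J ^+ 2 %| G) && [forall x, G.[x] == a x])
       (monics F e))%:R
    - q ^+ e / q ^+ #|F| * (q ^- 2) ^+ setdeg J| <=
  sieve_error q #|F| e (setdeg J).
Proof.
move=> D0 sJ; have sJI := fintype.subset_trans sJ (nonlinears_sub F D).
rewrite count_dvdp_monics; last by rewrite monic_exp // setprod_monic.
rewrite size_exp -/(setdeg J) /sieve_error muln2 -geq_half_double.
have [le_de|_] := leqP (setdeg J) e./2; last first.
  by rewrite sub0r normrN ger0_norm // mulr_ge0.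
have s0 x : (setprod J).[x] != 0 by apply: (@setprod_nonlinears_neq0 F D).
have -> : count (fun G => [forall x, (setprod J ^+ 2 * G).[x] == a x])
      (monics F (e - (setdeg J).*2)) =
    count (fun G => [forall x, G.[x] == a x / (setprod J).[x] ^+ 2])
      (monics F (e - (setdeg J).*2)).
  apply: eq_count => G; apply: eq_forallb => x.
  rewrite hornerM horner_exp mulrC.
  by rewrite -[RHS](inj_eq (mulIf (expf_neq0 2 (s0 x)))) divfK // expf_neq0.
exact: count_values_error.
Qed.

(** Nonzero values exclude linear factors, so only nonlinear irreducibles have to be sieved. *)
Lemma square_free_nonlinears (D e : nat) (a : F -> F) (G : {poly F}) :
  (e <= D)%N -> (0 < D)%N -> (forall x, a x != 0) -> G \in monics F e ->
  `[< square_free G >] && [forall x, G.[x] == a x] =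
  [forall P in nonlinears F D, ~~ ((P : {poly F}) ^+ 2 %| G)]
    && [forall x, G.[x] == a x].
Proof.
move=> eD D0 a0 GM; case: forallP => [Ga|]; last by rewrite !andbF.
rewrite !andbT (@square_free_irreds F D e) //.
apply/forall_inP/forall_inP => [nd P PA|nd P PI].
  by apply: nd; apply: (fintype.subsetP (nonlinears_sub F D)).
have [PA|] := boolP (P \in nonlinears F D); first exact: nd.
rewrite finset.inE PI andbT negbK => /imsetP[x _ ->].
apply/negP => /(dvdp_trans (dvdp_mulr _ (dvdpp _))).
rewrite npolypK ?size_XsubC // dvdp_XsubCl => /rootP Gx.
by have := a0 x; rewrite -(eqP (Ga x)) Gx eqxx.
Qed.

Lemma count_prescribed_values (a : F -> F) (e : nat) : (forall x, a x != 0) ->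
  `|(count (fun G => `[< square_free G >] && [forall x, G.[x] == a x])
       (monics F e))%:R
    - q ^+ e / q ^+ #|F| * ((1 - q^-1) / (1 - q ^- 2) ^+ #|F|)| <=
  3 * q ^+ e./2.
Proof.
move=> a0.
(* The cap [e.+1] is positive even for e = 0 and makes the truncation error of the Euler product
   negligible. *)
have sA := nonlinears_sub F e.+1.
rewrite (eq_in_count (fun G => square_free_nonlinears (leqnSn e) (ltn0Sn e) a0)).
rewrite (@count_sieve F K e.+1 2 e) //.
set rho := _ / (1 - q ^- 2) ^+ #|F|.
set R := \prod_(P in nonlinears F e.+1) (1 - (q ^- 2) ^+ (size (P : {poly F})).-1).
set S := \sum_(J in _) _.
have E0 : 0 <= q ^+ e / q ^+ #|F| by rewrite divr_ge0 ?ltW.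
have le_sieve : `|S - q ^+ e / q ^+ #|F| * R| <= 2 * q ^+ e./2.
  rewrite /R -euler_product // big_distrr -sumrB /=.
  have [B leB] := sum_setdeg_le sA (fun j => sieve_error_ge0 #|F| e j q_gt0).
  apply: (le_trans _ (le_trans leB _)); last first.
    exact: sum_sieve_error_le q3K (ltnW (ltnW q3)).
  apply: (le_trans (ler_norm_sum _ _ _)); apply: ler_sum => J.
  rewrite powersetE => sJ; rewrite mulrCA -mulrBr normrM normrX normrN1 expr1n.
  by rewrite mul1r; apply: count_dvdp_values.
have le_R := euler_product_nonlinears K q3 (ltn0Sn e).
(* Truncating the Euler product costs at most 1; added to the 2 of the sieve error, this gives the
   constant 3. *)
have ED : q ^+ e / q ^+ #|F| * q ^- e.+1 <= q ^+ e./2.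
  apply: (@le_trans _ _ 1); last by rewrite exprn_ege1.
  rewrite -mulrA -invfM -exprD ler_pdivrMr // mul1r ler_weXn2l //.
  by rewrite addnC ltnW // ltnS leq_addr.
have -> : S - q ^+ e / q ^+ #|F| * rho =
    (S - q ^+ e / q ^+ #|F| * R) + q ^+ e / q ^+ #|F| * (R - rho).
  by rewrite mulrBr addrA subrK.
apply: (le_trans (ler_normD _ _)); rewrite normrM (ger0_norm E0).
have -> : 3 * q ^+ e./2 = 2 * q ^+ e./2 + q ^+ e./2.
  by rewrite -[X in _ = _ + X]mul1r -mulrDl -(natrD K 2 1).
apply: lerD; first exact: le_sieve.
by apply: le_trans ED; apply: ler_wpM2l.
Qed.

End PrescribedCount.

(** * Sign patterns *)

(* Quadratic character refined to an [option]: [None] stands for the value [0],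
   [Some b] for [1] or [-1]. *)
Definition residue (F : finFieldType) (a : F) : option bool :=
  if a == 0 then None else Some [exists b : F, b ^+ 2 == a].

Definition residue_val (r : option bool) : int :=
  if r is Some b then (if b then 1 else -1) else 0.

Lemma quad_charE (F : finFieldType) (a : F) :
  quad_char a = residue_val (residue a).
Proof. by rewrite /quad_char /residue; case: ifP => // _; case: ifP. Qed.

Lemma residue_eq_None (F : finFieldType) (a : F) : (residue a == None) = (a == 0).
Proof. by rewrite /residue; case: (a == 0). Qed.

(** The translation by 1 permutes F, so it preserves the sum of all elements while adding [#|F|] to
    it. *)
Lemma card_natr_eq0 (F : finNzRingType) : #|F|%:R = 0 :> F.
Proof.
have /esym/eqP : \sum_(x : F) x = \sum_(x : F) (x + 1).
  by rewrite (reindex_inj (addIr 1)).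
by rewrite big_split -subr_eq0 addrAC subrr add0r sumr_const => /eqP.
Qed.

Lemma neg_neq (F : finFieldType) (b : F) : odd #|F| -> b != 0 -> b != - b.
Proof.
move=> oddF b0; rewrite -subr_eq0 opprK -mulr2n -mulr_natl mulf_neq0 //.
apply/eqP => two0; have := card_natr_eq0 F.
rewrite -(odd_double_half #|F|) oddF natrD -mul2n natrM two0 mul0r addr0.
by move/eqP; rewrite oner_eq0.
Qed.

(** Squaring is two-to-one from the nonzero elements onto the nonzero squares, the fibres being the
    pairs b, -b. *)
Lemma card_residue_true (F : finFieldType) : odd #|F| ->
  (#|[set t : F | residue t == Some true]%SET|.*2 = #|F|.-1)%N.
Proof.
move=> oddF; rewrite -(cardC1 (0 : F)) -[RHS]sum1_card.
rewrite (partition_big (fun b : F => b ^+ 2)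
   (fun t => t \in [set t : F | residue t == Some true]%SET)) /=; last first.
  move=> b b0; rewrite finset.inE /residue expf_eq0 /= (negPf b0).
  by apply/eqP; congr Some; apply/existsP; exists b.
rewrite -muln2 -sum_nat_const; apply: eq_bigr => t.
rewrite finset.inE /residue; case: (eqVneq t 0) => // t0 /eqP[/existsP[b /eqP eb]].
have b0 : b != 0 by apply: contraNneq t0 => b0; rewrite -eb b0 expr0n.
transitivity #|[set b; - b]%SET|; first by rewrite cards2 neg_neq.
rewrite -sum1_card; apply: eq_bigl => c; rewrite !finset.inE -eb eqf_sqr.
rewrite andb_idl // => /orP[] /eqP -> //; by rewrite oppr_eq0.
Qed.

Lemma card_residue (F : finFieldType) (b : bool) : odd #|F| ->
  (#|[set t : F | residue t == Some b]%SET|.*2 = #|F|.-1)%N.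
Proof.
move=> oddF; case: b; first exact: card_residue_true.
have := card_residue_true oddF.
have : (#|[set t : F | residue t == Some true]%SET| +
        #|[set t : F | residue t == Some false]%SET| = #|F|.-1)%N.
  rewrite -(cardC1 (0 : F)) -!sum1_card big_mkcond.
  rewrite [X in (_ + X)%N]big_mkcond [RHS]big_mkcond -big_split /=.
  apply: eq_bigr => t _; rewrite !finset.inE /residue.
  by case: (t == 0) => //=; case: [exists _, _].
by rewrite -addnn; lia.
Qed.

Lemma card_residue_mul (F : finFieldType) (c : F) (b : bool) : odd #|F| -> c != 0 ->
  (#|[set t : F | residue (c * t)%R == Some b]%SET|.*2 = #|F|.-1)%N.
Proof.
move=> oddF c0; rewrite -(card_residue b oddF); congr _.*2.
rewrite -(card_imset _ (mulfI c0)); apply: eq_card => t.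
apply/imsetP/idP => [[u + ->]|]; rewrite !finset.inE // => rt.
by exists (c^-1 * t); rewrite ?finset.inE mulVKf.
Qed.

Section SquareFreeProduct.
Variables (F : finFieldType) (Z : {set F}).
Implicit Types H : {poly F}.
Local Notation W := (\prod_(z in Z) ('X - z%:P) : {poly F}).

Lemma prod_roots_eq0 x : (W.[x] == 0) = (x \in Z).
Proof.
apply/eqP/idP => [|xZ]; last first.
  by rewrite horner_prod (bigD1 x) //= !hornerE subrr mul0r.
apply: contra_eqT => xZ; rewrite horner_prod prodf_seq_neq0.
apply/allP => z _; apply/implyP => zZ; rewrite !hornerE subr_eq0.
by apply: contraNneq xZ => ->.
Qed.

Lemma square_free_mulr (G H : {poly F}) : square_free (G * H) -> square_free H.
Proof. by move=> sf g g1; apply: contra (sf g g1); apply: dvdp_mull. Qed.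

(** A zero of [H] in [Z] would be a double root of the product. Conversely, a square factor [g ^+ 2]
    is treated according to whether [g] has a root in F. *)
Lemma square_free_prod_roots H : square_free (W * H) <->
  square_free H /\ (forall x, x \in Z -> H.[x] != 0).
Proof.
split=> [sf|[sf HZ] g g1].
  split=> [|x xZ]; first exact: square_free_mulr sf.
  have := sf ('X - x%:P); rewrite size_XsubC => /(_ isT); apply: contra => /eqP Hx.
  rewrite expr2 dvdp_mul // dvdp_XsubCl; last exact/rootP.
  by rewrite /root prod_roots_eq0.
have [[x gx]|nx] := pselect (exists x, root g x).
  have dx : ('X - x%:P) ^+ 2 %| g ^+ 2 by rewrite dvdp_exp2r // dvdp_XsubCl.
  apply/negP => /(dvdp_trans dx) {dx}.
  (* In [Z], a second factor [X - x] would divide the other linear factors or [H]; outside [Z], the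
     square of [X - x] is coprime to the product of roots and would divide [H]. *)
  have [xZ|xZ] := boolP (x \in Z).
    rewrite (bigD1 x) //= -mulrA expr2 dvdp_mul2l ?polyXsubC_eq0 // dvdp_XsubCl.
    rewrite rootM => /orP[|/rootP Hx]; last by have := HZ x xZ; rewrite Hx eqxx.
    rewrite /root horner_prod => /eqP/esym/eqP; apply/negP.
    rewrite eq_sym prodf_seq_neq0; apply/allP => z _; apply/implyP => /andP[_ zx].
    by rewrite !hornerE subr_eq0 eq_sym.
  rewrite Gauss_dvdpr; first by apply/negP/sf; rewrite size_XsubC.
  by rewrite coprimep_expl // coprimep_sym coprimep_XsubC /root prod_roots_eq0.
(* Without roots, [g] is coprime to every linear factor. *)
rewrite Gauss_dvdpr; first exact: sf.
rewrite coprimep_expl //; apply: (big_ind (fun h => coprimep g h)) => [|h k ch ck|z zZ].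
- exact: coprimep1.
- by rewrite coprimepMr ch ck.
- by rewrite coprimep_XsubC; apply/negP => gz; apply: nx; exists z.
Qed.

End SquareFreeProduct.

Section Patterns.
Variable F : finFieldType.
Implicit Types (sigma : {ffun F -> option bool}) (G H : {poly F}).

Definition zeros sigma : {set F} := [set x | sigma x == None]%SET.
Definition pattern_roots sigma : {poly F} := \prod_(z in zeros sigma) ('X - z%:P).

Definition has_pattern sigma G : bool := [forall x, residue G.[x] == sigma x].

(* [F = pattern_roots sigma * G] is square-free of pattern [sigma] exactly when [G]
   is square-free and all values [G x] are admissible. *)
Definition admissible sigma (x t : F) : bool :=
  if x \in zeros sigma then t != 0
  else residue ((pattern_roots sigma).[x] * t) == sigma x.

Lemma admissible_neq0 sigma x t : admissible sigma x t -> t != 0.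
Proof.
rewrite /admissible; case: ifP => // /negbT.
rewrite finset.inE => sx; apply: contraTneq => ->; rewrite mulr0.
by rewrite /residue eqxx eq_sym.
Qed.

(** The pattern forces divisibility by [pattern_roots sigma], and the cofactor is what remains to be
    counted. *)
Lemma count_pattern sigma d :
  count (fun G => `[< square_free G >] && has_pattern sigma G) (monics F d) =
  if (#|zeros sigma| <= d)%N then
    count (fun H => `[< square_free H >] && [forall x, admissible sigma x H.[x]])
      (monics F (d - #|zeros sigma|))
  else 0%N.
Proof.
set W := pattern_roots sigma.
have -> : count (fun G => `[< square_free G >] && has_pattern sigma G) (monics F d) =
    count (fun G => (W %| G) && (`[< square_free G >] && has_pattern sigma G))
      (monics F d).
  apply: eq_count => G; rewrite [RHS]andb_idl // => /andP[_ /forallP pG].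
  apply: prod_roots_dvd => x; rewrite finset.inE => /eqP sx.
  by apply/rootP/eqP; rewrite -residue_eq_None -sx pG.
rewrite (@count_dvdp_monics F W d
  (fun G => `[< square_free G >] && has_pattern sigma G)); last exact: monic_prod_roots.
rewrite size_prod_roots; case: ifP => // _; apply: eq_count => H.
apply/andP/andP => -[/asboolP sf /forallP pat]; split.
- by apply/asboolP; apply: square_free_mulr sf.
- apply/forallP => x; rewrite /admissible; case: ifP => [xZ|_].
    by have [_] := (square_free_prod_roots _ _).1 sf; apply.
  by have := pat x; rewrite hornerM.
- apply/asboolP/square_free_prod_roots; split=> // x _.
  exact: admissible_neq0 (pat x).
- apply/forallP => x; have := pat x; rewrite /admissible hornerM; case: ifP => // xZ _.
  have /eqP -> : W.[x] == 0 by rewrite prod_roots_eq0.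
  by move: xZ; rewrite mul0r finset.inE => /eqP ->; rewrite residue_eq_None.
Qed.

(** Every polynomial has exactly one pattern, and the pattern determines its character sum. *)
Lemma count_char_sum d (s : int) :
  count (fun G => `[< square_free G >] && (char_sum G == s)) (monics F d) =
  (\sum_(sigma : {ffun F -> option bool} | (\sum_x residue_val (sigma x))%R == s)
    count (fun G => `[< square_free G >] && has_pattern sigma G) (monics F d))%N.
Proof.
under [RHS]eq_bigr do rewrite -sum1_count big_mkcond.
rewrite -sum1_count big_mkcond exchange_big; apply: eq_bigr => G _.
pose tau : {ffun F -> option bool} := [ffun x => residue G.[x]].
have patE sigma : has_pattern sigma G = (sigma == tau).
  apply/forallP/eqP => [pG|-> x]; last by rewrite ffunE.
  by apply/ffunP => x; rewrite ffunE (eqP (pG x)).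
have -> : char_sum G = \sum_x residue_val (tau x).
  by apply: eq_bigr => x _; rewrite ffunE quad_charE.
case: `[< _ >] => /=; last by rewrite big1.
under [RHS]eq_bigr do rewrite patE.
rewrite -big_mkcondr /=.
under [RHS]eq_bigl => sigma.
  have -> : (\sum_x residue_val (sigma x) == s) && (sigma == tau) =
     (\sum_x residue_val (tau x) == s) && (sigma == tau).
    by case: (sigma =P tau) => [->|_]; rewrite ?andbT ?andbF.
  over.
case: (_ == s) => /=; first by rewrite big_pred1_eq.
by rewrite big_pred0_eq.
Qed.

Lemma count_by_values (P : F -> pred F) n :
  count (fun H => `[< square_free H >] && [forall x, P x H.[x]]) (monics F n) =
  (\sum_(a : {ffun F -> F} | [forall x, P x (a x)])
    count (fun H => `[< square_free H >] && [forall x, H.[x] == a x]) (monics F n))%N.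
Proof.
under [RHS]eq_bigr do rewrite -sum1_count big_mkcond.
rewrite -sum1_count big_mkcond exchange_big; apply: eq_bigr => G _.
pose b : {ffun F -> F} := [ffun x => G.[x]].
have valE (a : {ffun F -> F}) : [forall x, G.[x] == a x] = (a == b).
  apply/forallP/eqP => [Ga|-> x]; last by rewrite ffunE.
  by apply/ffunP => x; rewrite ffunE (eqP (Ga x)).
have -> : [forall x, P x G.[x]] = [forall x, P x (b x)].
  by apply: eq_forallb => x; rewrite ffunE.
case: `[< _ >] => /=; last by rewrite big1.
under [RHS]eq_bigr do rewrite valE.
rewrite -big_mkcondr /=.
under [RHS]eq_bigl => a.
  have -> : [forall x, P x (a x)] && (a == b) = [forall x, P x (b x)] && (a == b).
    by case: (a =P b) => [->|_]; rewrite ?andbT ?andbF.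
  over.
case: [forall x, P x (b x)] => /=; first by rewrite big_pred1_eq.
by rewrite big_pred0_eq.
Qed.

(** The conditions at different points are independent: any nonzero value at a zero of the pattern,
    half of the nonzero values elsewhere. *)
Lemma card_admissible (K : realFieldType) sigma : odd #|F| ->
  #|[set a : {ffun F -> F} | [forall x, admissible sigma x (a x)]]%SET|%:R =
  \prod_x (if sigma x == None then #|F|%:R - 1 else (#|F|%:R - 1) / 2) :> K.
Proof.
move=> oddF; rewrite -sum1_card natr_sum.
have q1 : #|F|%:R - 1 = #|F|.-1%:R :> K.
  by rewrite -[in LHS](ltn_predK (card_finNzRing_gt1 F)) -natr1 addrK.
transitivity (\prod_x \sum_(t : F) (admissible sigma x t)%:R : K).
  rewrite bigA_distr_bigA /= big_mkcond; apply: eq_bigr => a _.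
  rewrite finset.inE; case: forallP => [adm|nadm].
    by rewrite big1 // => x _; rewrite adm.
  have /existsP[x nx] : [exists x, ~~ admissible sigma x (a x)].
    by rewrite -negb_forall; apply/forallP.
  by rewrite (bigD1 x) //= (negPf nx) mul0r.
apply: eq_bigr => x _; rewrite -natr_sum.
have -> : (\sum_t admissible sigma x t)%N = #|[set t | admissible sigma x t]%SET|.
  by rewrite -sum1_card [RHS]big_mkcond; apply: eq_bigr => t _; rewrite finset.inE; case: ifP.
rewrite q1 /admissible finset.inE; case sx: (sigma x) => [b|] /=.
  rewrite -(@card_residue_mul F (pattern_roots sigma).[x] b oddF).
    by rewrite -muln2 natrM mulfK // pnatr_eq0.
  by rewrite prod_roots_eq0 finset.inE sx.
by rewrite -(cardC1 (0 : F)); congr _%:R; apply: eq_card => t; rewrite !inE.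
Qed.

End Patterns.

(** * Frequency of a single pattern *)

Section PatternFrequency.
Variables (F : finFieldType) (K : realFieldType).
Hypothesis oddF : odd #|F|.
Local Notation q := (#|F|%:R : K).
Implicit Types sigma : {ffun F -> option bool}.

Definition point_prob (r : option bool) : K :=
  if r is Some _ then 1 / (2 * (1 + q^-1)) else 1 / (q + 1).

Definition pattern_prob sigma : K := \prod_x point_prob (sigma x).

Let card3 : (3 <= #|F|)%N.
Proof. by have := card_finNzRing_gt1 F; case: #|F| oddF => [|[|[]]]. Qed.

Let q3K : 3 <= q. Proof. by rewrite (ler_nat K 3). Qed.
Let q_gt0 : 0 < q. Proof. exact: lt_le_trans q3K. Qed.

Lemma point_prob_gt0 r : 0 < point_prob r.
Proof.
have iq : 0 < q^-1 by rewrite invr_gt0.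
by case: r => [b|] /=; rewrite divr_gt0 // ?mulr_gt0 ?addr_gt0.
Qed.

Lemma pattern_prob_ge0 sigma : 0 <= pattern_prob sigma.
Proof. by apply: prodr_ge0 => x _; rewrite ltW ?point_prob_gt0. Qed.

(** Pointwise identity. The power of 1 - q^-2 will cancel the missing linear Euler factors, and
    [q ^+ #|zeros sigma|] restores the degree lost to the roots. *)
Lemma prod_admissible sigma :
  \prod_x (if sigma x == None then q - 1 else (q - 1) / 2) =
  pattern_prob sigma * q ^+ #|zeros sigma| * (q * (1 - q ^- 2)) ^+ #|F|.
Proof.
have -> : q ^+ #|zeros sigma| = \prod_x (if sigma x == None then q else 1).
  by rewrite -big_mkcond -prodr_const; apply: eq_bigl => x; rewrite finset.inE.
have -> : (q * (1 - q ^- 2)) ^+ #|F| = \prod_(x : F) (q * (1 - q ^- 2)).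
  by rewrite prodr_const.
rewrite -!big_split; apply: eq_bigr => x _ /=.
have q0 : q != 0 by rewrite gt_eqF.
have q10 : q + 1 != 0 by rewrite gt_eqF // addr_gt0.
have qi : 1 + q^-1 = (q + 1) / q by rewrite mulrDl divff // div1r.
by case: (sigma x) => [b|] /=; rewrite ?qi expr2; field; rewrite q0 q10.
Qed.

(** Sum of the estimate for prescribed values over all admissible value vectors: the main terms add
    up exactly, the errors are multiplied by the number of vectors. *)
Lemma count_pattern_error sigma d : (#|zeros sigma| <= d)%N ->
  `|(count (fun G => `[< square_free G >] && has_pattern sigma G)
      (monics F d))%:R - pattern_prob sigma * (q ^+ d * (1 - q^-1))| <=
  pattern_prob sigma *
    (3 * (q ^+ #|F| * q ^+ #|zeros sigma| * q ^+ (d - #|zeros sigma|)./2)).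
Proof.
move=> md; rewrite count_pattern md count_by_values natr_sum.
set m := #|zeros sigma|.
set C := (1 - q^-1) / (1 - q ^- 2) ^+ #|F|.
have /andP[b1 b2] := bernoulli_density K card3.
have b0 : 0 < (1 - q ^- 2) ^+ #|F| by apply: lt_le_trans b1.
have q0 : q != 0 by rewrite gt_eqF.
have cardA := card_admissible K sigma oddF.
rewrite prod_admissible in cardA.
have -> : pattern_prob sigma * (q ^+ d * (1 - q^-1)) =
    \sum_(a : {ffun F -> F} | [forall x, admissible sigma x (a x)])
      q ^+ (d - m) / q ^+ #|F| * C.
  rewrite (eq_bigl (fun a => a \in
     [set a : {ffun F -> F} | [forall x, admissible sigma x (a x)]]%SET)); last first.
    by move=> a; rewrite finset.inE.
  rewrite sumr_const -[RHS]mulr_natr cardA /C exprMn -{1}(subnK md) exprD -/m.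
  have qn0 : q ^+ #|F| != 0 by rewrite expf_neq0.
  have B0 : (1 - q ^- 2) ^+ #|F| != 0 by rewrite gt_eqF.
  move: (q ^+ #|F|) ((1 - q ^- 2) ^+ #|F|) qn0 B0 => x y x0 y0.
  by field; rewrite ?q0 ?x0 ?y0.
rewrite -sumrB; apply: (le_trans (ler_norm_sum _ _ _)).
apply: (@le_trans _ _ (\sum_(a : {ffun F -> F} |
    [forall x, admissible sigma x (a x)]) 3 * q ^+ (d - m)./2)).
  apply: ler_sum => a /forallP adm; apply: count_prescribed_values => // x.
  exact: admissible_neq0 (adm x).
rewrite (eq_bigl (fun a => a \in
   [set a : {ffun F -> F} | [forall x, admissible sigma x (a x)]]%SET)); last first.
  by move=> a; rewrite finset.inE.
rewrite sumr_const -[leLHS]mulr_natr cardA exprMn -/m.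
move: (q ^+ m) (q ^+ #|F|) (q ^+ (d - m)./2) ((1 - q ^- 2) ^+ #|F|) b2
  (exprn_ge0 m (ltW q_gt0)) (exprn_ge0 #|F| (ltW q_gt0))
  (exprn_ge0 (d - m)./2 (ltW q_gt0)) => x y z w w1 x0 y0 z0.
have -> : 3 * z * (pattern_prob sigma * x * (y * w)) =
    pattern_prob sigma * (3 * (y * x * z)) * w by ring.
by rewrite ler_piMr // !mulr_ge0 // pattern_prob_ge0.
Qed.

End PatternFrequency.

(** Twice the exponent on the left is at most 2n + m - d because 2h <= d - m, hence at most 3n -
    d. *)
Lemma powR_exponent_le (R : realType) (x : R) (n m h d : nat) :
  1 <= x -> (m <= n)%N -> (m <= d)%N -> (h.*2 <= d - m)%N ->
  x ^+ n * x ^+ m * x ^+ h / x ^+ d <= x `^ (((3 * n)%:R - d%:R) / 2).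
Proof.
move=> x1 mn md hd; have x0 : 0 < x by apply: lt_le_trans x1.
have -> : x ^+ n * x ^+ m * x ^+ h / x ^+ d = x `^ ((n + m + h)%:R - d%:R).
  rewrite powRB; last by rewrite (gt_eqF x0) implybT.
  by rewrite !powR_mulrn ?ltW // !exprD.
apply: ler_powR => //.
rewrite ler_pdivlMr // mulrBl -!natrM lerBrDl.
rewrite addrA lerBlDr -!natrD ler_nat.
by move: mn md hd; rewrite -!muln2; lia.
Qed.

Lemma pattern_freq_error (F : finFieldType) (R : realType)
    (sigma : {ffun F -> option bool}) d : odd #|F| -> (2 <= d)%N ->
  `|(count (fun G => `[< square_free G >] && has_pattern sigma G)
      (monics F d))%:R / #|sqfree_monic F d|%:R - pattern_prob R sigma| <=
  pattern_prob R sigma * (5 * #|F|%:R `^ (((3 * #|F|)%:R - d%:R) / 2)).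
Proof.
move=> oddF d2.
have q3 : (3 <= #|F|)%N.
  by have := card_finNzRing_gt1 F; case: #|F| oddF => [|[|[]]].
have q3K : 3 <= #|F|%:R :> R by rewrite (ler_nat R 3).
have q0 : 0 < #|F|%:R :> R by apply: lt_le_trans q3K.
have q1 : 1 <= #|F|%:R :> R by apply: le_trans q3K; rewrite (ler_nat R 1).
have zF : (#|zeros sigma| <= #|F|)%N by rewrite max_card.
have p0 := pattern_prob_ge0 R oddF sigma.
have -> : #|sqfree_monic F d|%:R = #|F|%:R ^+ d * (1 - #|F|%:R^-1) :> R.
  rewrite -count_square_free //; congr _%:R.
  have := card_sqfree_monic d (fun _ : {poly F} => true).
  rewrite (eq_count (a2 := fun G => `[< square_free G >])); last first.
    by move=> G; rewrite andbT.
  by move=> <-; apply: eq_card => f; rewrite [RHS]finset.inE andbT.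
set M := _ ^+ d * _.
have iq : #|F|%:R^-1 <= 1 / 3 :> R by rewrite div1r lef_pV2 ?posrE.
have qd0 : 0 < #|F|%:R ^+ d :> R by rewrite exprn_gt0.
have M23 : #|F|%:R ^+ d * (2 / 3) <= M.
  apply: ler_wpM2l; first exact: ltW.
  by clear - iq; lra.
have M0 : 0 < M by apply: lt_le_trans M23; rewrite mulr_gt0.
(* With more zeros than the degree the frequency is 0; then d < q, so the power of q in the bound is
   at least 1. *)
have [md|dm] := leqP #|zeros sigma| d; last first.
  rewrite count_pattern leqNgt dm /= mul0r sub0r normrN (ger0_norm p0).
  have P1 : 1 <= #|F|%:R `^ (((3 * #|F|)%:R - d%:R) / 2) :> R.
    rewrite -[leLHS](powRr0 #|F|%:R); apply: ler_powR => //.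
    rewrite divr_ge0 // subr_ge0 ler_nat (leq_trans (ltnW dm)) //.
    by rewrite (leq_trans zF) // leq_pmull.
  apply: ler_peMr => //; move: (_ `^ _) P1 => P P1; clear - P1; lra.
have -> : (count (fun G => `[< square_free G >] && has_pattern sigma G)
      (monics F d))%:R / M - pattern_prob R sigma =
    ((count (fun G => `[< square_free G >] && has_pattern sigma G)
      (monics F d))%:R - pattern_prob R sigma * M) / M.
  by rewrite mulrBl mulfK // gt_eqF.
rewrite normrM normfV (gtr0_norm M0) ler_pdivrMr //.
apply: (le_trans (count_pattern_error R oddF md)).
rewrite -[leRHS]mulrA; apply: ler_wpM2l => //.
set m := #|zeros sigma| in zF md *.
have hd : ((d - m)./2.*2 <= d - m)%N by rewrite -geq_half_double.
(* Dividing the constant 3 by 1 - 1/q >= 2/3 gives 9/2, rounded up to 5. *)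
have := powR_exponent_le q1 zF md hd.
rewrite ler_pdivrMr //.
set A := _ * _ ^+ (d - m)./2; set P := _ `^ _ => AP.
have P0 : 0 <= P by apply: powR_ge0.
have PM := ler_wpM2l P0 M23; have PM0 : 0 <= P * M by rewrite mulr_ge0 // ltW.
rewrite mulrA in PM; rewrite -[leRHS]mulrA.
move: (P * M) (P * _) A AP PM PM0 => PM PQ A AP le_PM PM0.
by clear - AP le_PM PM0; lra.
Qed.

(** * The random model *)

Lemma probability_finite_union (disp : measure_display) (T : measurableType disp)
    (R : realType) (P : probability T R) (I : finType) (E : I -> set T)
    (p : I -> R) (Q : pred I) :
  (forall i, measurable (E i)) -> trivIset setT E ->
  (forall i, P (E i) = (p i)%:E) ->
  measurable (\bigcup_(i in [set` Q]) E i) /\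
  P (\bigcup_(i in [set` Q]) E i) = (\sum_(i | Q i) p i)%:E.
Proof.
move=> mE tE pE; have -> : [set` Q] = [set` enum Q].
  by apply/seteqP; split => i /=; rewrite mem_enum.
split; first by apply: fin_bigcup_measurable.
rewrite measure_fin_bigcup //; last by apply: sub_trivIset tE.
rewrite -fsbig_seq ?enum_uniq // big_enum /= -sumEFin.
by apply: eq_bigr.
Qed.

(** The events have total mass 1 but may miss a null set, so [A] is bounded below by the events
    inside it and above through those inside its complement. *)
Lemma probability_of_partition (disp : measure_display) (T : measurableType disp)
    (R : realType) (P : probability T R) (I : finType) (E : I -> set T)
    (p : I -> R) (Q : pred I) (A : set T) :
  (forall i, measurable (E i)) -> trivIset setT E ->
  (forall i, P (E i) = (p i)%:E) -> \sum_i p i = 1 -> measurable A ->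
  (forall i, Q i -> E i `<=` A) -> (forall i, ~~ Q i -> E i `<=` ~` A) ->
  P A = (\sum_(i | Q i) p i)%:E.
Proof.
move=> mE tE pE p1 mA QA nQA.
have [mU PU] := probability_finite_union Q mE tE pE.
have [mV PV] := probability_finite_union (predC Q) mE tE pE.
apply/eqP; rewrite eq_le; apply/andP; split; last first.
  rewrite -PU; apply: le_measure; rewrite ?inE //.
  by move=> w [i Qi]; apply: QA.
have le_compl : (P (\bigcup_(i in [set` predC Q]) E i) <= P (~` A))%E.
  apply: le_measure; rewrite ?inE //; first exact: measurableC.
  by move=> w [i Qi]; apply: nQA.
move: le_compl; rewrite PV probability_setC // -(fineK (fin_num_measure P A mA)).
rewrite -EFinB !lee_fin lerBrDl -lerBrDr => /le_trans; apply.
by rewrite -p1 (bigID Q) /= addrK.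
Qed.

Lemma sum_point_prob (K : realFieldType) (F : finFieldType) :
  \sum_(r : option bool) point_prob F K r = 1.
Proof.
rewrite (bigD1 None) // (bigD1 (Some true)) // (bigD1 (Some false)) //= big1.
  have q0 : 0 < #|F|%:R :> K.
    by rewrite ltr0n (ltn_trans _ (card_finNzRing_gt1 F)).
  have q10 : #|F|%:R + 1 != 0 :> K by rewrite gt_eqF // addr_gt0.
  have -> : 1 + #|F|%:R^-1 = (#|F|%:R + 1) / #|F|%:R :> K.
    by rewrite mulrDl divff ?gt_eqF // div1r.
  by field; rewrite q10 gt_eqF.
by case=> [[]|].
Qed.

Lemma sum_prob_patterns (R : realType) (F : finFieldType)
    (disp : measure_display) (T : measurableType disp) (P : probability T R)
    (X : 'I_#|F| -> {RV P >-> R}) (s : int) :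
  iid_point_model X ->
  sum_prob X s =
  \sum_(sigma : {ffun F -> option bool} |
        (\sum_x residue_val (sigma x))%R == s) pattern_prob R sigma.
Proof.
move=> [indX pmfX].
(* The enumeration of F matches the index of the variables with the points of F. *)
pose v (sigma : {ffun F -> option bool}) (i : 'I_#|F|) : R :=
  (residue_val (sigma (enum_val i)))%:~R.
pose E sigma : set T := \bigcap_(i in [set` [set: 'I_#|F|]%SET]) (X i @^-1` [set v sigma i]).
have EP sigma w : E sigma w <-> forall i, X i w = v sigma i.
  split=> [Ew i|Ew i _]; last exact: Ew.
  by apply: (Ew i); rewrite /= finset.inE.
have mE1 sigma i : measurable (X i @^-1` [set v sigma i]).
  rewrite -[_ @^-1` _]setTI; apply: measurable_funP => //; exact: measurable_set1.
have mE sigma : measurable (E sigma).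
  by apply: fin_bigcap_measurable => // i _; apply: mE1.
have v_inj sigma tau : (forall i, v sigma i = v tau i) -> sigma = tau.
  move=> e; apply/ffunP => x; have /intr_inj := e (enum_rank x).
  by rewrite enum_rankK; case: (sigma x) (tau x) => [[]|] [[]|].
have tE : trivIset setT E.
  move=> sigma tau _ _ [w [/EP Es /EP Et]]; apply: v_inj => i.
  by rewrite -Es Et.
have PE sigma : P (E sigma) = (pattern_prob R sigma)%:E.
  rewrite /E indX; last by move=> i _; apply: measurable_set1.
  rewrite /pattern_prob (reindex _ (onW_bij _ (@enum_val_bij F))) -prodEFin.
  apply: eq_big => [i|i _]; first by rewrite finset.inE.
  rewrite -(fineK (fin_num_measure P _ (mE1 sigma i))) -/(pmf (X i) _).
  have [p0 p1 pN1] := pmfX i; rewrite /v.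
  by case: (sigma _) => [[]|] /=; rewrite ?p1 ?p0 ?pN1.
rewrite /sum_prob; set A := [set w | _].
have mA : measurable A.
  have -> : A = setT `&` (fun w => \sum_(i < #|F|) X i w) @^-1` [set s%:~R].
    by rewrite setTI.
  by apply: measurable_sum => //; exact: measurable_set1.
rewrite (@probability_of_partition _ _ _ P _ E (@pattern_prob F R)
  (fun sigma => \sum_x residue_val (sigma x) == s) A) //.
- by rewrite -(bigA_distr_bigA (fun _ : F => point_prob F R)) big1 // => x _;
    exact: sum_point_prob.
- move=> sigma /eqP es w /EP Ew; rewrite /A /= -es rmorph_sum (reindex _ (onW_bij _ (@enum_val_bij F))).
  by apply: eq_bigr => i _; rewrite Ew.
- move=> sigma /eqP ns w /EP Ew Aw; apply: ns; apply: (@intr_inj R).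
  rewrite -Aw rmorph_sum (reindex _ (onW_bij _ (@enum_val_bij F))).
  by apply: eq_bigr => i _; rewrite Ew.
Qed.

Section Frequency.
Variables (R : realType) (F : finFieldType).
Variables (disp : measure_display) (T : measurableType disp).
Variables (P : probability T R) (X : 'I_#|F| -> {RV P >-> R}).
Hypotheses (oddF : odd #|F|) (iidX : iid_point_model X).

Lemma sum_prob_ge0 (s : int) : 0 <= sum_prob X s.
Proof.
by rewrite sum_prob_patterns //; apply: sumr_ge0 => sigma _; apply: pattern_prob_ge0.
Qed.

(** The relative error is the same for all patterns, so the bounds add up to the same relative error
    for their sum. *)
Lemma char_sum_freq_error (d : nat) (s : int) : (2 <= d)%N ->
  `|char_sum_freq R F d s - sum_prob X s| <=
  sum_prob X s * (5 * #|F|%:R `^ (((3 * #|F|)%:R - d%:R) / 2)).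
Proof.
move=> d2; rewrite sum_prob_patterns // /char_sum_freq.
rewrite (card_sqfree_monic d (fun G => char_sum G == s)) count_char_sum.
rewrite natr_sum mulr_suml -sumrB mulr_suml.
apply: (le_trans (ler_norm_sum _ _ _)); apply: ler_sum => sigma _.
exact: pattern_freq_error.
Qed.

End Frequency.

(** This is a geometric sequence of ratio x^(-1/2). *)
Lemma powR_exponent_cvg0 (R : realType) (x c : R) : 1 < x ->
  (fun d : nat => x `^ ((c - d%:R) / 2)) @ \oo --> 0.
Proof.
move=> x1; have x0 : 0 < x by apply: lt_trans x1.
set y := x `^ (- 2^-1).
have y1 : `|y| < 1.
  rewrite ger0_norm ?powR_ge0 // /y powRN invf_lt1 ?powR_gt0 //.
  have e1 : 1 `^ 2^-1 = 1 :> R by rewrite powR1.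
  rewrite -[ltLHS]e1; apply: gt0_ltr_powR => //.
  - by rewrite nnegrE.
  - by rewrite nnegrE ltW.
have -> : (fun d : nat => x `^ ((c - d%:R) / 2)) = geometric (x `^ (c / 2)) y.
  apply/funext => d; rewrite /geometric /= mulrBl powRD; last first.
    by rewrite (gt_eqF x0) implybT.
  congr (_ * _); rewrite -powR_mulrn ?powR_ge0 // /y -powRrM mulNr.
  by rewrite [_ * d%:R]mulrC.
exact: cvg_geometric.
Qed.

Theorem theorem1 (R : realType) :
  (forall (F : finFieldType) (disp : measure_display)
     (T : measurableType disp) (P : probability T R)
     (X : 'I_#|F| -> {RV P >-> R}) (s : int),
     odd #|F| -> iid_point_model X ->
     (fun d : nat => char_sum_freq R F d s) @ \oo --> sum_prob X s)
  /\
  (exists C : R,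
     forall (F : finFieldType) (disp : measure_display)
       (T : measurableType disp) (P : probability T R)
       (X : 'I_#|F| -> {RV P >-> R}) (d : nat) (s : int),
       odd #|F| -> iid_point_model X ->
       (3 <= d)%N -> `|s| <= #|F|%:Z ->
       exists theta : R,
         `|theta| <= C * (#|F|%:R `^ (((3 * #|F|)%:R - d%:R) / 2)) /\
         char_sum_freq R F d s = sum_prob X s * (1 + theta)).
Proof.
split=> [F disp T P X s oddF iidX|].
  suff : (fun d => char_sum_freq R F d s - sum_prob X s) @ \oo --> (0 : R).
    by move/(subr_cvg0 (fun d => char_sum_freq R F d s)).
  apply: norm_cvg0.
  have bound0 : (fun d : nat => sum_prob X s *
      (5 * #|F|%:R `^ (((3 * #|F|)%:R - d%:R) / 2))) @ \oo --> (0 : R).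
    rewrite -[X in _ --> X](mulr0 (sum_prob X s)) -[X in _ * X](mulr0 5).
    apply: cvgM; first exact: cvg_cst.
    apply: cvgM; first exact: cvg_cst.
    by apply: powR_exponent_cvg0; rewrite (ltr_nat R 1) card_finNzRing_gt1.
  apply: (@squeeze_cvgr _ _ _ _ (fun=> 0) _ _ _ _ _ bound0); last exact: cvg_cst.
  near=> d; rewrite normr_ge0 /=; apply: char_sum_freq_error => //.
  by near: d; exact: nbhs_infty_ge.
exists 5 => F disp T P X d s oddF iidX d3 _.
have err := char_sum_freq_error oddF iidX s (ltnW d3).
(* If the probability is 0, the error bound forces the frequency to be 0 and theta = 0 serves;
   otherwise theta is the quotient minus 1. *)
have [p0|p0] := eqVneq (sum_prob X s) 0.
  exists 0; rewrite normr0 mulr_ge0 ?powR_ge0 //; split=> //.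
  by move: err; rewrite p0 !mul0r subr0 normr_le0 => /eqP.
exists (char_sum_freq R F d s / sum_prob X s - 1); split; last first.
  by rewrite addrC subrK mulrC divfK.
have pgt0 : 0 < sum_prob X s by rewrite lt0r p0 sum_prob_ge0.
rewrite -(ler_pM2l pgt0); apply: le_trans err.
by rewrite -[X in X * _]gtr0_norm // -normrM mulrBr mulr1 mulrC divfK.
Unshelve. all: by end_near. Qed.
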